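(* Let $A$ be a set of nonnegative integers and let $(A_q)_{q=1}^{\infty}$ be a strictly decreasing sequence of sets of nonnegative integers such that $A = \bigcap_{q=1}^{\infty} A_q$. Then $\mathcal{H}(A_q) = \mathbf{N}$.
   Context: $\mathbf{N} = \{1,2,3,\ldots\}$ is the set of positive integers. For a set $A$ of integers and $h \in \mathbf{N}$, the $h$-fold sumset $hA$ is the set of all sums $a_1+\cdots+a_h$ of $h$ not necessarily distinct elements of $A$ (so $h\emptyset = \emptyset$). A sequence of sets $(A_q)_{q=1}^{\infty}$ is strictly decreasing if $A_{q+1} \subseteq A_q$ and $A_{q+1} \neq A_q$ for all $q \in \mathbf{N}$. For a strictly decreasing sequence $(A_q)_{q=1}^{\infty}$ of sets of integers with $A = \bigcap_{q=1}^{\infty} A_q$, define $\mathcal{H}(A_q) = \{h \in \mathbf{N} : hA = \bigcap_{q=1}^{\infty} hA_q\}$; this set depends on the whole sequence. *)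

(* Defs.v *)
From mathcomp Require Import all_boot all_order all_algebra.
From mathcomp Require Import boolp classical_sets.

Set Implicit Arguments.
Unset Strict Implicit.
Unset Printing Implicit Defensive.

Import Order.TTheory GRing.Theory Num.Theory.

Local Open Scope classical_set_scope.
Local Open Scope ring_scope.

Definition posN : set nat := [set n | (0 < n)%N].

Definition nonneg : set int := [set x | 0 <= x].

Definition sumset (h : nat) (A : set int) : set int :=
  [set x | exists2 a : 'I_h -> int, (forall i, A (a i)) & x = \sum_(i < h) a i].

(* A sequence (A_q) indexed by the positive integers is a function on nat
   whose value at 0 is never used. *)
Definition strictly_decreasing (Aq : nat -> set int) : Prop :=
  forall q, posN q -> Aq q.+1 `<=` Aq q /\ Aq q.+1 <> Aq q.

Definition calH (Aq : nat -> set int) : set nat :=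
  [set h | posN h /\
    sumset h (\bigcap_(q in posN) Aq q) = \bigcap_(q in posN) sumset h (Aq q)].

(* Main.v *)
Require Import Defs.
From mathcomp Require Import all_boot all_order all_algebra.
From mathcomp Require Import boolp classical_sets.

(** Only the inclusion of the intersection of the h-fold sumsets in the sumset
    of the intersection needs an argument. Let x lie in every h A_q. Since the
    A_q consist of nonnegative integers, all summands of a representation of x
    lie in {0, ..., x}, so there are only finitely many h-tuples that can ever
    represent x ([sumset_bounded]). A tuple with entries in A_q also has its
    entries in every earlier set of the sequence; hence, by compactness of a
    finite set ([decreasing_finite_compact]), a single tuple has its entries in
    all A_q simultaneously, and it represents x in h A. *)

Import Order.TTheory GRing.Theory Num.Theory.

Local Open Scope classical_set_scope.
Local Open Scope ring_scope.

Lemma strictly_decreasing_subset (Aq : nat -> set int) (p q : nat) :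
  strictly_decreasing Aq -> (0 < p)%N -> (p <= q)%N -> Aq q `<=` Aq p.
Proof.
move=> decr p_gt0 /subnKC <-; elim: (q - p)%N => [|k IHk]; first by rewrite addn0.
rewrite addnS; apply: subset_trans IHk.
by apply: (decr _ _).1; rewrite /posN /= ltn_addr.
Qed.

Lemma sumsetS (h : nat) (A B : set int) :
  A `<=` B -> sumset h A `<=` sumset h B.
Proof. by move=> AB x [a Aa ->]; exists a => // i; apply: AB. Qed.

(** If every t failed at some stage, all would fail at the maximum of these
    finitely many stages. *)
Lemma decreasing_finite_compact (T : finType) (P : nat -> T -> Prop) :
  (forall p q t, (p <= q)%N -> P q t -> P p t) ->
  (forall q, exists t, P q t) -> exists t, forall q, P q t.
Proof.
move=> Pdecr Pex; apply: contrapT => /forallNP noP.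
have /choice [stage stageP] : forall t, exists q, ~ P q t.
  by move=> t; apply/existsNP/noP.
have [t Pt] := Pex (\max_t stage t)%N.
by apply: (stageP t); apply: Pdecr Pt; apply: leq_bigmax.
Qed.

(** Each summand is at most the total because the other summands are
    nonnegative; this confines all representations of x to one finite type. *)
Lemma sumset_bounded (h : nat) (A : set int) (x : int) :
  A `<=` nonneg -> sumset h A x ->
  exists f : {ffun 'I_h -> 'I_`|x|.+1},
    (forall i, A (f i : nat)%:Z) /\ x = \sum_(i < h) (f i : nat)%:Z.
Proof.
move=> A_ge0 [a Aa x_sum]; have a_ge0 i : 0 <= a i by exact: A_ge0.
have a_le i : a i <= x.
  by rewrite x_sum (bigD1 i) //= lerDl sumr_ge0.
have a_lt i : (`|a i| < `|x|.+1)%N.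
  by rewrite ltnS -lez_nat !gez0_abs // (le_trans (a_ge0 i)).
exists [ffun i => Ordinal (a_lt i)].
have fE i : ([ffun i => Ordinal (a_lt i)] i : nat)%:Z = a i.
  by rewrite ffunE /= gez0_abs.
split=> [i|]; first by rewrite fE.
by rewrite [LHS]x_sum; apply: eq_bigr => i _; rewrite fE.
Qed.

Theorem theorem2 (A : set int) (Aq : nat -> set int)
    (A_nonneg : A `<=` nonneg)
    (Aq_nonneg : forall q, posN q -> Aq q `<=` nonneg)
    (Aq_decr : strictly_decreasing Aq)
    (A_cap : A = \bigcap_(q in posN) Aq q) :
  calH Aq = posN.
Proof.
apply/seteqP; split=> [h []//|h h_gt0]; split=> //.
apply/seteqP; split=> x.
  by move=> hAx q q_gt0; apply: sumsetS hAx; apply: bigcap_inf.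
move=> hAqx.
have [|q|f fP] := @decreasing_finite_compact {ffun 'I_h -> 'I_`|x|.+1}
  (fun q f => (forall i, Aq q.+1 (f i : nat)%:Z)
              /\ x = \sum_(i < h) (f i : nat)%:Z).
- move=> p q f le_pq [fA x_sum]; split=> // i.
  exact: (@strictly_decreasing_subset Aq p.+1 q.+1).
- by apply: sumset_bounded; [apply: Aq_nonneg | apply: hAqx].
exists (fun i => (f i : nat)%:Z); last by have [] := fP 0%N.
by move=> i [//|q] _; have [fA _] := fP q; apply: fA.
Qed.
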